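(* Let $G$ and $H$ be graphs, each having $k\ge 2$ connected components, and suppose there is $n\in\mathbb{N}$ such that every connected component of $G$ and every connected component of $H$ has order $n$, $n+1$ or $n+2$. Then $q(G\vee H)=2$.
   Context: Graphs are finite, simple, with nonempty vertex sets; the order of a graph is its number of vertices. $G\vee H$ is the join (disjoint union plus all edges between $G$ and $H$). $S(G)$ is the set of real symmetric matrices whose off-diagonal entry $(i,j)$ is nonzero iff $\{i,j\}$ is an edge (diagonal free), and $q(G)$ is the minimum number of distinct eigenvalues of a matrix in $S(G)$. *)

(* Defs.v *)
From HB Require Import structures.
From mathcomp Require Import all_boot all_order all_algebra finmap.
From mathcomp Require Import boolp classical_sets cardinality reals.

Set Implicit Arguments.
Unset Strict Implicit.
Unset Printing Implicit Defensive.

Import Order.TTheory GRing.Theory Num.Theory.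

Local Open Scope ring_scope.

Record sgraph : Type := SGraph {
  vertex :> finType;
  edge : rel vertex;
  edge_sym : symmetric edge;
  edge_irrefl : irreflexive edge;
  vertex_nonempty : (0 < #|vertex|)%N }.

Section Join.
Variables G H : sgraph.

Definition join_edge : rel (G + H)%type := fun u v =>
  match u, v with
  | inl x, inl y => edge x y
  | inr x, inr y => edge x y
  | _, _ => true
  end.

Fact join_edge_sym : symmetric join_edge.
Proof. by move=> [x|x] [y|y] //=; rewrite edge_sym. Qed.

Fact join_edge_irrefl : irreflexive join_edge.
Proof. by move=> [x|x] /=; rewrite edge_irrefl. Qed.

Fact join_nonempty : (0 < #|{: G + H}|)%N.
Proof. by rewrite card_sum addn_gt0 vertex_nonempty. Qed.

Definition join : sgraph :=
  SGraph join_edge_sym join_edge_irrefl join_nonempty.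
End Join.

Definition components (G : sgraph) : {set {set G}} :=
  equivalence_partition (connect (@edge G)) [set: G].

Section MinimumNumberOfEigenvalues.
Variable R : realType.

(* Rows and columns are indexed by the vertices through [enum_val]. *)
Definition inS (G : sgraph) (A : 'M[R]_#|G|) : Prop :=
  A^T = A /\
  forall i j : 'I_#|G|, i != j ->
    (A i j != 0) = edge (enum_val i) (enum_val j).

Lemma finite_eigenvalues m (A : 'M[R]_m) :
  finite_set [set a | eigenvalue A a]%classic.
Proof.
pose p := char_poly A.
have p0 : p != 0 by rewrite monic_neq0 // char_poly_monic.
have [s hs] : exists s : seq R, forall a, root p a -> a \in s.
  elim: {p}(size p) {-2}p (leqnn (size p)) p0 => [|d IH] p szp p0.
    by move: p0; rewrite -size_poly_eq0 -leqn0 szp.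
  have [[a ra]|nor] := pselect (exists a, root p a); last first.
    by exists [::] => a ra; case: nor; exists a.
  have [r defp] := factor_theorem p a ra.
  have r0 : r != 0 by apply: contraNneq p0 => r0; rewrite defp r0 mul0r.
  have [|//|s hs] := IH r.
    by move: szp; rewrite defp size_Mmonic ?monicXsubC // size_XsubC addn2.
  exists (a :: s) => b; rewrite defp rootM root_XsubC inE.
  by case/orP => [/hs ->|->]; rewrite ?orbT.
apply: (@sub_finite_set _ _ [set` s]%classic); last exact: finite_seq.
by move=> a /=; rewrite eigenvalue_root_char; apply: hs.
Qed.

(* [fset_set] is the junk value [fset0] on infinite sets, which is excluded
   here by [finite_eigenvalues].  For a real symmetric matrix every complex
   eigenvalue is real, so counting the eigenvalues in [R] loses none. *)
Definition num_eigenvalues m (A : 'M[R]_m) : nat :=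
  #|` fset_set [set a | eigenvalue A a]%classic|.

Definition attains (G : sgraph) : pred nat := fun m =>
  `[< exists A : 'M[R]_#|G|, inS A /\ num_eigenvalues A = m >].

Fact attains_nonempty (G : sgraph) : exists m, attains G m.
Proof.
pose A : 'M[R]_#|G| := \matrix_(i, j) (edge (enum_val i) (enum_val j))%:R.
exists (num_eigenvalues A); apply/asboolP; exists A; split=> //; split.
  by apply/matrixP => i j; rewrite !mxE edge_sym.
by move=> i j _; rewrite mxE pnatr_eq0 eqb0 negbK.
Qed.

Definition q (G : sgraph) : nat := ex_minn (attains_nonempty G).

End MinimumNumberOfEigenvalues.

(* Main.v *)
Require Import Defs.
From mathcomp Require Import all_boot all_order all_algebra reals.
From HB Require Import structures.
From mathcomp Require Import finmap boolp classical_sets functions cardinality.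
From mathcomp Require Import interval_inference topology normedtype sequences.
From mathcomp Require Import complex ring lra zify.

(* Since the join has an edge, no matrix of its pattern is scalar, so q >= 2 by
   the spectral theorem; it remains to find a symmetric matrix M of the pattern
   with M^2 = 1.

   Take n distinct numbers l_1 > ... > l_n in (0, 1).  For G we build a matrix A
   of pattern G such that on every component the eigenvalues are l_1, ..., l_n,
   plus -1 (order n+1) or -1 and 1 (order n+2), and such that the eigenvectors
   for l_1 are nowhere zero on their components.  A is a small perturbation of a
   diagonal matrix: the prescribed spectrum amounts to a quadratic fixed point
   equation for the matrix of eigenvectors, solved by contraction.  The edge
   weights are +1 or -1 times a small constant, and if 1 is an eigenvalue, it is
   attached to a neighbour of the vertex carrying l_1; the signs are chosen so
   that a Perron-Frobenius argument applies to the eigenvector of l_1, although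
   l_1 is then only the second largest eigenvalue.

   Let A' be such a matrix for H, and let the columns of F_s, F'_s be the k unit
   eigenvectors for l_s, one per component.  Put
     M = [[A, B], [B^T, -A']],
     B = sum_s sqrt (1 - l_s^2) F_s Q_s F'_s^T
   with orthogonal k x k matrices Q_s; then M^2 = 1.  With Q_s = 1 for s > 1 and
   Q_1 the Householder reflection along (1, t, ..., t^(k-1)), every entry of B
   is, as k >= 2, a nonzero rational function of t, so some t makes B nowhere
   zero. *)

Set Implicit Arguments.
Unset Strict Implicit.
Unset Printing Implicit Defensive.

Import Order.TTheory GRing.Theory Num.Theory.

Local Open Scope ring_scope.

(** * Fixed points of contractions on matrices *)

Section FixedPoint.
Import numFieldNormedType.Exports.
Local Open Scope classical_set_scope.

(** Banach's theorem needs square matrices as a complete normed module. *)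
HB.instance Definition _ (R : realType) m := Complete.on 'M[R]_m.

Lemma mx_norm_leP (R : realType) m (U : 'M[R]_m) (d : R) : 0 <= d ->
  reflect (forall i j, `|U i j| <= d) (`|U| <= d).
Proof.
move=> d0; rewrite [leLHS]mx_normrE.
apply: (iffP (bigmax_leP _ _ _ _)) => [[_ h] i j|h].
  exact: (h (i, j)).
by split=> // -[i j] _; apply: h.
Qed.

(** Banach's theorem on the closed unit ball of the max norm, with every norm bound spelled out
    entrywise. *)
Lemma half_contraction_fixpoint (R : realType) m (f : 'M[R]_m -> 'M[R]_m) :
  (forall U : 'M[R]_m, (forall i j, `|U i j| <= 1) -> forall i j, `|f U i j| <= 1) ->
  (forall (U V : 'M[R]_m) (d : R), (forall i j, `|U i j| <= 1) -> (forall i j, `|V i j| <= 1) ->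
    0 <= d -> (forall i j, `|U i j - V i j| <= d) ->
    forall i j, `|f U i j - f V i j| <= d / 2) ->
  exists2 U : 'M[R]_m, (forall i j, `|U i j| <= 1) & U = f U.
Proof.
move=> fB fL; pose B := [set U : 'M[R]_m | `|U| <= 1].
have BP U : B U <-> forall i j, `|U i j| <= 1.
  by split=> [/mx_norm_leP|h]; [apply|apply/mx_norm_leP].
have fBB : set_fun B B f by move=> U /BP h; apply/BP; apply: fB.
have [F fF] := Pfun fBB.
have ctr : is_contraction F.
  have h0 : 0 <= 2^-1 :> R by rewrite invr_ge0.
  exists (NngNum h0); split=> /=; first by lra.
  move=> [U V] [/= BU BV]; rewrite -fF.
  apply/mx_norm_leP; first by rewrite mulr_ge0.
  move=> i j; rewrite !mxE mulrC; apply: fL => //; try exact/BP.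
  move=> i' j'; have /mx_norm_leP := lexx `|U - V|.
  by move=> /(_ (normr_ge0 _) i' j'); rewrite !mxE.
have cB : closed B.
  rewrite (_ : B = Num.norm @^-1` [set x : R | x <= 1]) //.
  apply: closed_comp => [x _|]; [exact: norm_continuous|exact: closed_le].
have B0 : B !=set0 by exists 0; rewrite /B /= normr0 ler01.
have [U /BP BU UE] := banach_fixed_point ctr cB B0.
by exists U => //; rewrite fF.
Qed.
End FixedPoint.

Lemma ler_norm_mulmx (R : realDomainType) m (U W : 'M[R]_m) (a : R) i j :
  (forall x y, `|U x y| <= a) -> (forall x y, `|W x y| <= 1) ->
  `|(U *m W) i j| <= m%:R * a.
Proof.
move=> hU hW; rewrite mxE (le_trans (ler_norm_sum _ _ _)) //.
rewrite mulr_natl -[in leRHS](card_ord m) -sumr_const ler_sum // => l _.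
by rewrite normrM -[leRHS]mulr1 ler_pM.
Qed.

(* With N i j = (mu i - mu j)^-1, a fixed point of this map is a matrix whose
   rows are eigenvectors of diag (mu j - eps (U W)_jj) + eps W, for the
   eigenvalues mu i. *)
Definition eigenvector_map (R : nzRingType) m (eps : R) (N W U : 'M[R]_m) : 'M[R]_m :=
  \matrix_(i, j) ((i == j)%:R
    + eps * (N i j * ((U *m W) i j - (U *m W) j j * U i j))).

Lemma eigenvector_mapE (R : nzRingType) m (eps : R) (N W U : 'M[R]_m) i j :
  eigenvector_map eps N W U i j = (i == j)%:R
    + eps * (N i j * ((U *m W) i j - (U *m W) j j * U i j)).
Proof. exact: mxE. Qed.

(** On the unit ball the off-diagonal entries are at most [2 * eps * L * m <= 1/4], and the
    Lipschitz constant is at most [3 * eps * L * m <= 3/8]. *)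
Lemma eigenvector_map_fixpoint (R : realType) m (eps L : R) (N W : 'M[R]_m) :
  0 <= eps -> 0 <= L -> eps * L * m%:R <= 8^-1 ->
  (forall i, N i i = 0) -> (forall i j, `|N i j| <= L) ->
  (forall i j, `|W i j| <= 1) ->
  exists2 U : 'M[R]_m, (forall i j, `|U i j| <= 1) & U = eigenvector_map eps N W U.
Proof.
move=> eps0 L0 small N0 NL W1.
have scale x i j : `|eps * (N i j * x)| <= eps * L * `|x|.
  by rewrite !normrM (ger0_norm eps0) mulrA ler_wpM2r // ler_wpM2l.
apply: half_contraction_fixpoint => [U U1 i j|U V d U1 V1 d0 UV i j]; rewrite !eigenvector_mapE.
  have [->|ij] := eqVneq i j; first by rewrite N0 mul0r mulr0 addr0 normr1.
  rewrite add0r (le_trans (scale _ _ _)) //.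
  have h1 := ler_norm_mulmx i j U1 W1; have h2 := ler_norm_mulmx j j U1 W1.
  have h3 : `|(U *m W) j j * U i j| <= m%:R * 1.
    by rewrite normrM -[leRHS]mulr1 ler_pM.
  have h4 : `|(U *m W) i j - (U *m W) j j * U i j| <= 2 * m%:R.
    by rewrite (le_trans (ler_normB _ _)) //; lra.
  have := ler_wpM2l (mulr_ge0 eps0 L0) h4; move: small; lra.
pose D := U - V.
have D1 x y : `|D x y| <= d by rewrite !mxE.
have DW x y : (U *m W) x y - (V *m W) x y = (D *m W) x y.
  by rewrite mulmxBl !mxE.
(* The quadratic term splits as [(U W)_jj U_ij - (V W)_jj V_ij = (U W)_jj D_ij + (D W)_jj V_ij]. *)
rewrite (_ : _ - _ = eps * (N i j * ((D *m W) i j - (U *m W) j j * D i j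
  - (D *m W) j j * V i j))); last by rewrite -!DW !mxE; ring.
rewrite (le_trans (scale _ _ _)) //.
have h1 := ler_norm_mulmx i j D1 W1; have h2 := ler_norm_mulmx j j D1 W1.
have h3 : `|(U *m W) j j * D i j| <= m%:R * d.
  by rewrite normrM ler_pM // -[m%:R]mulr1 ler_norm_mulmx.
have h4 : `|(D *m W) j j * V i j| <= m%:R * d.
  by rewrite normrM -[leRHS]mulr1 ler_pM.
have h5 : `|(D *m W) i j - (U *m W) j j * D i j - (D *m W) j j * V i j|
    <= 3 * (m%:R * d).
  rewrite (le_trans (ler_normB _ _)) // (le_trans (lerD (ler_normB _ _) (lexx _))) //.
  lra.
have := ler_wpM2l (mulr_ge0 eps0 L0) h5; have := ler_wpM2r d0 small; lra.
Qed.

(** * Matrices of a given pattern with prescribed spectrum *)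

Section SpectralRealization.
Variables (R : realType) (m k : nat) (e : rel 'I_m) (c : 'I_m -> 'I_k).
Variables (mu : 'I_m -> R) (root : 'I_k -> 'I_m).
Hypothesis m_gt0 : (0 < m)%N.
Hypothesis e_sym : symmetric e.
Hypothesis e_c : forall i j, e i j -> c i = c j.
(** Connectedness of the fibres of [c], phrased as propagation along edges; it will be applied to
    the zero set of an eigenvector. *)
Hypothesis c_conn : forall P : pred 'I_m, (forall i j, e i j -> P i -> P j) ->
  forall i j, c i = c j -> P i -> P j.
Hypothesis mu_inj : forall i j, c i = c j -> mu i = mu j -> i = j.
Hypothesis c_root : forall x, c (root x) = x.
Hypothesis root_top : forall i, mu (root (c i)) < mu i -> e i (root (c i)).

Let above i := mu (root (c i)) < mu i.

(* With these signs, every edge at a vertex below the root contributes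
   nonnegatively to the eigenvector equation of the root's eigenvalue, once the
   entries above the root are negative and all others nonnegative. *)
Let W : 'M[R]_m := \matrix_(i, j)
  if e i j then
    if (above i && (j != root (c j))) || (above j && (i != root (c i)))
    then -1 else 1
  else 0.

(** The default [0^-1 = 0] kills the diagonal, so a fixed point has diagonal entries 1. *)
Let N : 'M[R]_m := \matrix_(i, j) if c i == c j then (mu i - mu j)^-1 else 0.
Let L : R := 1 + \sum_i \sum_j `|N i j|.
Let M : R := m%:R.
(** One factor [M] makes the map a contraction; the second keeps the absolute sum of the off-root
    entries of a root's row at most 1/4. *)
Let eps : R := (8 * L * M * M)^-1.

Let W_sym i j : W i j = W j i.
Proof. by rewrite !mxE e_sym orbC. Qed.

Let W1 i j : `|W i j| <= 1.
Proof.
by rewrite mxE; case: ifP => _; [case: ifP => _|]; rewrite ?normrN ?normr1 ?normr0.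
Qed.

Let W_neq0 i j : (W i j != 0) = e i j.
Proof.
by rewrite mxE; case: ifP => _; [case: ifP; rewrite ?oppr_eq0 oner_eq0|rewrite eqxx].
Qed.

Let L_ge1 : 1 <= L.
Proof. by rewrite lerDl sumr_ge0 // => i _; rewrite sumr_ge0. Qed.

Let N_le i j : `|N i j| <= L.
Proof.
rewrite /L (bigD1 i) //= (bigD1 j) //=.
have h1 : 0 <= \sum_(l | l != j) `|N i l| by rewrite sumr_ge0.
have h2 : 0 <= \sum_(l | l != i) \sum_j `|N l j|.
  by rewrite sumr_ge0 // => l _; rewrite sumr_ge0.
lra.
Qed.

Let M_ge1 : 1 <= M. Proof. by rewrite ler1n. Qed.

Let eps_gt0 : 0 < eps.
Proof. by rewrite invr_gt0 !mulr_gt0 //; move: L_ge1 M_ge1; lra. Qed.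

Let eps_def : eps * L * M * M = 8^-1.
Proof.
rewrite /eps; field.
by apply/andP; split; apply: lt0r_neq0; move: L_ge1 M_ge1; lra.
Qed.

Let eps_small : eps * L * M <= 8^-1.
Proof.
rewrite -eps_def ler_peMr // ?M_ge1 //.
by rewrite !mulr_ge0 // ?(ltW eps_gt0) //; move: L_ge1 M_ge1; lra.
Qed.

Let gap i j : c i = c j -> i != j -> 1 <= L * `|mu i - mu j|.
Proof.
move=> cij ij; have := N_le i j; rewrite mxE cij eqxx normfV.
have d0 : 0 < `|mu i - mu j|.
  by rewrite normr_gt0 subr_eq0; apply: contraNneq ij => /(mu_inj cij)->.
by rewrite -[_^-1]mul1r ler_pdivrMr.
Qed.

Section EigenvectorMatrix.
Variable U : 'M[R]_m.
Hypothesis U1 : forall i j, `|U i j| <= 1.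
Hypothesis U_fix : U = eigenvector_map eps N W U.

Let UE i j : U i j = (i == j)%:R
    + eps * (N i j * ((U *m W) i j - (U *m W) j j * U i j)).
Proof. by rewrite {1}U_fix eigenvector_mapE. Qed.

Let U_diag i : U i i = 1.
Proof. by rewrite UE [N _ _]mxE !eqxx subrr invr0 mul0r mulr0 addr0. Qed.

Let U_supp i j : c i != c j -> U i j = 0.
Proof.
move=> cij; rewrite UE [N _ _]mxE (negPf cij) mul0r mulr0 addr0.
by have [ij|//] := eqVneq i j; move: cij; rewrite ij eqxx.
Qed.

Let UW_supp i j : c i != c j -> (U *m W) i j = 0.
Proof.
move=> cij; rewrite mxE big1 // => l _.
have [il|il] := eqVneq (c i) (c l); last by rewrite U_supp ?mul0r.
suff /negbFE/eqP-> : W l j != 0 = false by rewrite mulr0.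
by rewrite W_neq0; apply: contraNF cij => /e_c <-; rewrite il.
Qed.

(** With this correction the eigenvector equation of row [j] holds at [j] itself, because
    [U j j = 1]. *)
Let d j := mu j - eps * (U *m W) j j.

Let U_eigen i j : U i j * d j + eps * (U *m W) i j = mu i * U i j.
Proof.
have [cij|cij] := eqVneq (c i) (c j); last first.
  by rewrite U_supp // UW_supp // !(mul0r, mulr0) addr0.
have [->|ij] := eqVneq i j; first by rewrite U_diag /d; ring.
have mu_ij : mu i - mu j != 0.
  by rewrite subr_eq0; apply: contraNneq ij => /(mu_inj cij)->.
have := UE i j; rewrite (negPf ij) add0r [N i j]mxE cij eqxx.
move=> /(congr1 (fun x => (mu i - mu j) * x)).
rewrite (mulrCA (mu i - mu j)) mulVKf // /d => h.
by rewrite -[RHS](subrK (mu j * U i j)) -mulrBl h; ring.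
Qed.

Let A := diag_mx (\row_j d j) + eps *: W.

Let A_sym : A^T = A.
Proof.
rewrite /A linearD /= tr_diag_mx linearZ /=; congr (_ + _ *: _).
by apply/matrixP => i j; rewrite mxE W_sym.
Qed.

Let A_pattern i j : i != j -> (A i j != 0) = e i j.
Proof.
move=> ij; rewrite -W_neq0 !mxE (negPf ij) mulr0n add0r mulf_eq0.
by rewrite gt_eqF.
Qed.

Let UA i j : (U *m A) i j = mu i * U i j.
Proof.
by rewrite mulmxDr mul_mx_diag -scalemxAr -U_eigen mxE [X in X + _]mxE
  [X in _ + X]mxE mxE.
Qed.

(** Within a component the rows belong to distinct eigenvalues of the symmetric [A]; across
    components their supports are disjoint. *)
Let orthogonal_rows i j : i != j -> (U *m U^T) i j = 0.
Proof.
move=> ij; have [cij|cij] := eqVneq (c i) (c j); last first.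
  rewrite mxE big1 // => l _; rewrite mxE.
  have [il|il] := eqVneq (c i) (c l); last by rewrite (U_supp il) mul0r.
  by rewrite [U j l]U_supp ?mulr0 // -il eq_sym.
have UAU x y : (U *m A *m U^T) x y = mu x * (U *m U^T) x y.
  by rewrite !mxE mulr_sumr; apply: eq_bigr => l _; rewrite UA mulrA.
have sym B x y : (B : 'M[R]_m)^T = B -> B x y = B y x.
  by move=> BT; rewrite -[in LHS]BT mxE.
have h : mu i * (U *m U^T) i j = mu j * (U *m U^T) i j.
  rewrite -UAU sym ?UAU; last by rewrite !trmx_mul trmxK A_sym mulmxA.
  by congr (_ * _); apply: sym; rewrite trmx_mul trmxK.
apply/eqP; move/eqP: h; rewrite -subr_eq0 -mulrBl mulf_eq0 subr_eq0.
by case/orP => // /eqP /(mu_inj cij) /eqP; rewrite (negPf ij).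
Qed.

Let shift_small j : `|L * (eps * (U *m W) j j)| <= 8^-1.
Proof.
rewrite mulrA normrM mulrC [L * eps]mulrC.
have Leps : 0 <= eps * L by rewrite mulr_ge0 ?(ltW eps_gt0) //; move: L_ge1; lra.
rewrite (ger0_norm Leps) mulrC (le_trans _ eps_small) // ler_wpM2l //.
by rewrite -[M]mulr1 ler_norm_mulmx.
Qed.

Section RootEigenvector.
Variable x : 'I_k.
Let r := root x.

(** Scaled by [L], eigenvalue gaps within a component are at least 1 and the shift [mu j - d j] is
    at most 1/8 in size, so for [j != r] in the component [mu r - d j] has the sign of
    [mu r - mu j]. *)
Let root_eqn j : U r j * (L * (mu r - d j)) = eps * L * (U *m W) r j.
Proof.
have h := U_eigen r j.
transitivity (L * (mu r * U r j - U r j * d j)); first by ring.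
by rewrite -h; ring.
Qed.

Let U_off j : j != r -> `|U r j| <= 2 * (eps * L * M).
Proof.
rewrite eq_sym => rj; rewrite UE (negPf rj) add0r.
rewrite !normrM (gtr0_norm eps_gt0).
have h1 := ler_norm_mulmx r j U1 W1; have h2 := ler_norm_mulmx j j U1 W1.
have h3 : `|(U *m W) j j * U r j| <= m%:R * 1.
  by rewrite normrM -[leRHS]mulr1 ler_pM.
have h4 : `|(U *m W) r j - (U *m W) j j * U r j| <= 2 * M.
  by rewrite (le_trans (ler_normB _ _)) // /M; lra.
have -> : 2 * (eps * L * M) = eps * (L * (2 * M)) by ring.
by rewrite ler_wpM2l ?(ltW eps_gt0) // ler_pM.
Qed.

(** The edge to the root contributes 1 to [(U *m W) r j] and all other terms at most 1/4 in total,
    while the factor [mu r - d j] is negative. *)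
Let above_neg j : c j = x -> above j -> U r j < 0.
Proof.
move=> cj; rewrite /above => aj; rewrite cj -/r in aj.
have jr : j != r by apply: contraTneq aj => ->; rewrite ltxx.
have ejr : e j r by rewrite /r -cj root_top // cj.
have Wrj : W r j = 1.
  by rewrite mxE e_sym ejr /above /r c_root ltxx eqxx andbF.
have sumsmall : `|\sum_(l | l != r) U r l * W l j| <= 4^-1.
  rewrite (le_trans (ler_norm_sum _ _ _)) //.
  apply: (@le_trans _ _ (\sum_(l : 'I_m) 2 * (eps * L * M))); last first.
    rewrite sumr_const card_ord -mulr_natl -/M.
    by have := eps_def; lra.
  rewrite [leRHS](bigID (fun l => l != r)) /=.
  apply: (@le_trans _ _ (\sum_(l | l != r) 2 * (eps * L * M))).
    by apply: ler_sum => l lr; rewrite normrM -[leRHS]mulr1 ler_pM // U_off.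
  rewrite lerDl sumr_ge0 // => _ _.
  by rewrite !mulr_ge0 ?(ltW eps_gt0) //; move: L_ge1 M_ge1; lra.
have UWpos : 0 < (U *m W) r j.
  rewrite mxE (bigD1 r) //= Wrj U_diag mulr1.
  by move: sumsmall; rewrite ler_norml => /andP[]; lra.
have g : L * (mu r - mu j) <= -1.
  have := gap (_ : c r = c j) (_ : r != j); rewrite /r c_root cj eq_sym -/r.
  move=> /(_ erefl jr); rewrite ltr0_norm ?subr_lt0 //; lra.
have s := shift_small j; rewrite ler_norml in s; case/andP: s => s1 s2.
have neg : L * (mu r - d j) < 0 by rewrite /d; lra.
have := root_eqn j.
have pos : 0 < eps * L * (U *m W) r j.
  by rewrite !mulr_gt0 //; move: L_ge1; lra.
move=> E; move: pos; rewrite -E => pos.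
by rewrite ltNge; apply/negP => U0; have := mulr_ge0_le0 U0 (ltW neg); lra.
Qed.

Let weight_below l j : ~~ above j -> j != r -> c j = x -> e l j ->
  W l j = if above l then -1 else 1.
Proof.
by move=> aj jr cj elj; rewrite mxE elj (negPf aj) /= orbF cj -/r jr andbT.
Qed.

(** Minimum principle: a negative minimum [u] over the vertices not above the root would satisfy
    [u / 8 <= u * (7 / 8)]. *)
Let below_nonneg j : c j = x -> ~~ above j -> 0 <= U r j.
Proof.
move=> cj aj; pose S := [pred l | (c l == x) && ~~ above l].
have Sr : S r by rewrite /S /= /above /r c_root eqxx ltxx.
have [j0 /andP[/eqP cj0 aj0] minj0] := @arg_minP _ _ _ r S (fun l => U r l) Sr.
apply: le_trans (minj0 j _); last by rewrite /S /= cj eqxx.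
rewrite leNgt; apply/negP => v0.
have j0r : j0 != r by apply: contraTneq v0 => ->; rewrite U_diag -leNgt ler01.
(* Neighbours above the root contribute positively, through their weight -1; the other neighbours
   contribute at least the minimum, and non-neighbours 0. *)
have UWge : M * U r j0 <= (U *m W) r j0.
  have -> : M * U r j0 = \sum_(l : 'I_m) U r j0.
    by rewrite sumr_const card_ord mulr_natl.
  rewrite mxE ler_sum // => l _.
  have [el|] := boolP (e l j0); last first.
    by rewrite -W_neq0 negbK => /eqP->; rewrite mulr0 ltW.
  have cl : c l = x by rewrite (e_c el).
  rewrite weight_below //; case: ifPn => al.
    by have := above_neg cl al; lra.
  by rewrite mulr1 minj0 // /S /= cl eqxx.
have g : 1 <= L * (mu r - mu j0).
  have := gap (_ : c r = c j0) (_ : r != j0); rewrite /r c_root cj0 eq_sym -/r.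
  move=> /(_ erefl j0r); rewrite ger0_norm // subr_ge0 leNgt.
  by move: aj0; rewrite /above cj0.
have s := shift_small j0; rewrite ler_norml in s; case/andP: s => s1 s2.
have big : 7 / 8 <= L * (mu r - d j0) by rewrite /d; lra.
have E := root_eqn j0.
have h1 : U r j0 * (L * (mu r - d j0)) <= U r j0 * (7 / 8).
  by rewrite ler_wnM2l // ltW.
have Leps : 0 <= eps * L by rewrite mulr_ge0 ?(ltW eps_gt0) //; move: L_ge1; lra.
have h2 := ler_wpM2l Leps UWge.
have h3 : U r j0 * 8^-1 <= U r j0 * (eps * L * M) by rewrite ler_wnM2l // ltW.
have h4 : U r j0 * 8^-1 <= U r j0 * (7 / 8).
  rewrite (le_trans h3) // (le_trans _ h1) // E (le_trans _ h2) //.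
  by rewrite [leRHS]mulrA [leRHS]mulrC.
by move: h4; rewrite ler_nM2l //; lra.
Qed.

(** At a zero of the row, the equation is a vanishing sum of nonnegative terms, so all neighbours
    are zeros too. By connectedness the zeros would reach the root, where the entry is 1. *)
Fact root_nowhere_zero j : c j = x -> U r j != 0.
Proof.
move=> cj; apply/negP => Uj.
pose Z := [pred l | (c l == x) && (U r l == 0)].
suff : Z r by rewrite /Z /= U_diag oner_eq0 andbF.
apply: (c_conn (P := Z)) (_ : c j = c r) _; last first.
- by rewrite /Z /= cj eqxx.
- by rewrite /r c_root.
move=> {Uj cj}j l ejl /andP[/eqP cj Uj].
have cl : c l = x by rewrite -(e_c ejl).
have jr : j != r by apply: contraTneq Uj => ->; rewrite U_diag oner_eq0.
have aj : ~~ above j.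
  by apply/negP => /(above_neg cj); rewrite (eqP Uj) ltxx.
have sum0 : \sum_l U r l * W l j = 0.
  have := root_eqn j; rewrite (eqP Uj) mul0r => /esym/eqP.
  rewrite mulf_eq0 mulf_eq0 (gt_eqF eps_gt0) /= gt_eqF /=; last by move: L_ge1; lra.
  by rewrite mxE => /eqP.
have ge0 l' : 0 <= U r l' * W l' j.
  have [el|] := boolP (e l' j); last first.
    by rewrite -W_neq0 negbK => /eqP->; rewrite mulr0.
  have cl' : c l' = x by rewrite (e_c el).
  rewrite weight_below //; case: ifPn => al.
    by have := above_neg cl' al; lra.
  by rewrite mulr1 below_nonneg.
have /psumr_eq0P := sum0 => /(_ (fun l' _ => ge0 l') l isT)/eqP.
by rewrite mulf_eq0 -[_ || _]negbK negb_or W_neq0 e_sym ejl andbT negbK /Z /= cl eqxx.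
Qed.

End RootEigenvector.

Lemma eigenvector_matrix_realization :
  exists A U : 'M[R]_m, [/\ A^T = A /\ (forall i j, i != j -> (A i j != 0) = e i j),
    U *m U^T = 1%:M, U *m A = diag_mx (\row_j mu j) *m U,
    (forall i j, c i != c j -> U i j = 0) &
    forall j, U (root (c j)) j != 0].
Proof.
pose nrm i := Num.sqrt ((U *m U^T) i i).
have nrm_gt0 i : 0 < nrm i.
  rewrite sqrtr_gt0 mxE (bigD1 i) //= mxE U_diag mulr1 ltr_wpDr //.
  by apply: sumr_ge0 => l _; rewrite mxE -expr2 sqr_ge0.
pose V : 'M[R]_m := \matrix_(i, j) ((nrm i)^-1 * U i j).
have VE : V = diag_mx (\row_i (nrm i)^-1) *m U.
  by rewrite mul_diag_mx; apply/matrixP => i j; rewrite !mxE.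
exists A, V; split; first by split; [exact: A_sym|exact: A_pattern].
- apply/matrixP => i j.
  have -> : (V *m V^T) i j = (nrm i)^-1 * (nrm j)^-1 * (U *m U^T) i j.
    rewrite !mxE mulr_sumr; apply: eq_bigr => l _; rewrite !mxE; ring.
  have [->|ij] := eqVneq i j; last first.
    by rewrite orthogonal_rows // mulr0 mxE (negPf ij).
  rewrite [RHS]mxE eqxx mulr1n -[in LHS](sqr_sqrtr (_ : 0 <= (U *m U^T) j j)); last first.
    by rewrite mxE sumr_ge0 // => l _; rewrite mxE -expr2 sqr_ge0.
  by rewrite -/(nrm j); field; rewrite gt_eqF.
- rewrite VE -mulmxA.
  have -> : U *m A = diag_mx (\row_j mu j) *m U.
    by apply/matrixP => i j; rewrite UA mul_diag_mx !mxE.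
  by rewrite !mulmxA diag_mxC.
- by move=> i j cij; rewrite mxE U_supp // mulr0.
- move=> j; rewrite mxE mulf_neq0 ?invr_neq0 ?(gt_eqF (nrm_gt0 _)) //.
  exact: root_nowhere_zero.
Qed.

End EigenvectorMatrix.

Lemma spectral_realization :
  exists A U : 'M[R]_m, [/\ A^T = A /\ (forall i j, i != j -> (A i j != 0) = e i j),
    U *m U^T = 1%:M, U *m A = diag_mx (\row_j mu j) *m U,
    (forall i j, c i != c j -> U i j = 0) &
    forall j, U (root (c j)) j != 0].
Proof.
have [||||||U U1 U_fix] := @eigenvector_map_fixpoint R m eps L N W.
- exact: ltW.
- by move: L_ge1; lra.
- exact: eps_small.
- by move=> i; rewrite mxE eqxx subrr invr0.
- exact: N_le.
- exact: W1.
exact: eigenvector_matrix_realization U1 U_fix.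
Qed.

End SpectralRealization.

(* Targets for the t-th vertex of a component: the first n values are the
   eigenvalues shared by all components, and the surplus vertices n and n.+1 get
   the eigenvalues -1 and 1, which need no partner in the other graph. *)
Definition level (R : realType) (n t : nat) : R :=
  if (t < n)%N then t.+2%:R^-1 else if t == n then -1 else 1.

Lemma level_inj (R : realType) n t u :
  (t < n.+2)%N -> (u < n.+2)%N -> level R n t = level R n u -> t = u.
Proof.
have pos v : 0 < v.+2%:R^-1 :> R by rewrite invr_gt0.
have lt1 v : v.+2%:R^-1 < 1 :> R by rewrite invf_lt1 ?ltr1n.
have inj v w : v.+2%:R^-1 = w.+2%:R^-1 :> R -> v = w.
  by move=> /invr_inj/eqP; rewrite eqr_nat => /eqP[].
rewrite /level => tn un.
have [tln|tgn] := ltnP t n; have [uln|ugn] := ltnP u n; first exact: inj.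
- move: (pos t) (lt1 t); move: (t.+2%:R^-1) => a.
  by have [_|_] := eqVneq u n => ? ? ?; exfalso; lra.
- move: (pos u) (lt1 u); move: (u.+2%:R^-1) => a.
  by have [_|_] := eqVneq t n => ? ? ?; exfalso; lra.
- have [->|tn'] := eqVneq t n; have [->|un'] := eqVneq u n => // E.
  - by exfalso; lra.
  - by exfalso; lra.
  - by lia.
Qed.

Lemma level_gt0_lt1 (R : realType) n t : (t < n)%N -> 0 < level R n t < 1.
Proof. by rewrite /level => ->; rewrite invr_gt0 invf_lt1 ?ltr1n ?ltr0n. Qed.

Lemma level_sqr (R : realType) n t : (n <= t)%N -> level R n t ^+ 2 = 1.
Proof. by rewrite /level ltnNge => ->; case: eqP => _; rewrite ?sqrrN expr1n. Qed.

(** The shared levels decrease from 1/2, and the surplus value -1 lies below them, so only the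
    surplus value 1 can exceed the root's. *)
Lemma level_gt_level0 (R : realType) n t :
  (t < n.+3)%N -> level R n.+1 0 < level R n.+1 t -> t = n.+2.
Proof.
move=> tn; have [//|t2] := eqVneq t n.+2; rewrite /level ltn0Sn.
have [tln|tgn] := ltnP t n.+1.
  by rewrite ltf_pV2 ?posrE ?ltr0n // ltr_nat.
have -> : t = n.+1 by lia.
rewrite eqxx => h; have : 0 < 2^-1 :> R by rewrite invr_gt0.
by rewrite ltNge (ltW (lt_trans h _)) // oppr_lt0.
Qed.

(** * Eigenvectors sorted by shared eigenvalue and component *)

Section SpectralFrame.
Variables (R : realType) (m k n : nat) (e : rel 'I_m) (c : 'I_m -> 'I_k).
Variable verts : 'I_k -> seq 'I_m.
Hypothesis m_gt0 : (0 < m)%N.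
Hypothesis e_sym : symmetric e.
Hypothesis e_c : forall i j, e i j -> c i = c j.
Hypothesis c_conn : forall P : pred 'I_m, (forall i j, e i j -> P i -> P j) ->
  forall i j, c i = c j -> P i -> P j.
Hypothesis verts_uniq : forall x, uniq (verts x).
Hypothesis mem_verts : forall x i, (i \in verts x) = (c i == x).
(** The base order is [n.+1], so position 0 always exists. At size [n.+3] the last position [n.+2]
    carries the eigenvalue 1 and must be adjacent to the root at position 0. *)
Hypothesis verts_size : forall x, (n < size (verts x) < n.+4)%N.
Hypothesis verts_edge : forall x i0, size (verts x) = n.+3 ->
  e (nth i0 (verts x) n.+2) (nth i0 (verts x) 0).

Let i0 : 'I_m := Ordinal m_gt0.
Let pos i := index i (verts (c i)).
Let mu i : R := level R n.+1 (pos i).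
Let v t x := nth i0 (verts x) t.

Let pos_lt i : (pos i < size (verts (c i)))%N.
Proof. by rewrite index_mem mem_verts. Qed.

Let c_v t x : (t < size (verts x))%N -> c (v t x) = x.
Proof. by move=> tx; apply/eqP; rewrite -mem_verts mem_nth. Qed.

Let pos_v t x : (t < size (verts x))%N -> pos (v t x) = t.
Proof. by move=> tx; rewrite /pos c_v // index_uniq. Qed.

Let v_pos i : v (pos i) (c i) = i.
Proof. by rewrite /v nth_index // mem_verts. Qed.

Let lt_size (t : 'I_n.+1) x : (t < size (verts x))%N.
Proof. by case/andP: (verts_size x) => + _; apply: leq_trans; rewrite ltn_ord. Qed.

Let mu_inj i j : c i = c j -> mu i = mu j -> i = j.
Proof.
move=> cij /level_inj pij; rewrite -(v_pos i) -(v_pos j) cij pij //.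
  by have := pos_lt i; have /andP[_] := verts_size (c i); lia.
by have := pos_lt j; have /andP[_] := verts_size (c j); lia.
Qed.

Let root_top i : mu (v 0 (c i)) < mu i -> e i (v 0 (c i)).
Proof.
have h := pos_lt i; have /andP[s1 s2] := verts_size (c i).
rewrite /mu pos_v; last by lia.
move=> /level_gt_level0 pi; have {}pi : pos i = n.+2 by apply: pi; lia.
by rewrite -[X in e X _]v_pos pi; apply: verts_edge; lia.
Qed.

(** Meant for the weights [1 - mu i ^+ 2], which vanish at the surplus vertices, leaving only the
    shared levels. *)
Lemma big_verts (f : 'I_m -> R) : (forall i, (n < pos i)%N -> f i = 0) ->
  \sum_i f i = \sum_(t < n.+1) \sum_x f (v t x).
Proof.
move=> f0; rewrite (partition_big c predT) //= exchange_big /=.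
apply: eq_bigr => x _.
rewrite (eq_bigl (fun i => i \in verts x)); last by move=> i; rewrite mem_verts.
rewrite -big_uniq //= (big_nth i0) (@big_cat_nat _ _ _ n.+1) //=; last first.
  by case/andP: (verts_size x).
rewrite [X in _ + X]big_nat [X in _ + X]big1 ?addr0 ?big_mkord // => t.
by case/andP=> nt tx; apply: f0; rewrite -/(v t x) pos_v.
Qed.

(** Column [x] of [F t] is the row of [U] at the vertex in position [t] of component [x]; position 0
    is the root, whence the nowhere zero entries of [F ord0]. *)
Lemma spectral_frame :
  exists (A : 'M[R]_m) (F : 'I_n.+1 -> 'M[R]_(m, k)),
  [/\ A^T = A /\ (forall i j, i != j -> (A i j != 0) = e i j),
      forall t : 'I_n.+1, A *m F t = level R n.+1 t *: F t,
      forall t u, (F t)^T *m F u = (t == u)%:R%:M,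
      1%:M - A *m A = \sum_(t < n.+1) (1 - level R n.+1 t ^+ 2) *: (F t *m (F t)^T) &
      forall i x, (F ord0 i x != 0) = (c i == x)].
Proof.
have c_root x : c (v 0 x) = x by apply: c_v; case/andP: (verts_size x); lia.
have [A [U [[AT Ae] UU UA Usupp Uroot]]] :=
  spectral_realization m_gt0 e_sym e_c c_conn mu_inj c_root root_top.
exists A, (fun t : 'I_n.+1 => \matrix_(i, x) U (v t x) i); split; first by [].
- move=> t; apply/matrixP => i x.
  transitivity ((U *m A) (v t x) i).
    rewrite -{1}AT !mxE; apply: eq_bigr => l _; rewrite !mxE mulrC //.
  by rewrite UA mul_diag_mx !mxE /mu pos_v.
- move=> t u; apply/matrixP => x y.
  transitivity ((U *m U^T) (v t x) (v u y)).
    by rewrite !mxE; apply: eq_bigr => l _; rewrite !mxE.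
  rewrite UU !mxE; have [<-|tu] := eqVneq t u.
    rewrite (_ : _ == _ = (x == y)) //; apply/eqP/eqP => [|->//].
    by move=> /(congr1 c); rewrite !c_v.
  rewrite mul0rn; case: eqP => // /(congr1 pos); rewrite !pos_v // => /ord_inj tu'.
  by rewrite tu' eqxx in tu.
- have UTU : U^T *m U = 1%:M by exact: mulmx1C.
  have AE : A = U^T *m diag_mx (\row_j mu j) *m U.
    by rewrite -mulmxA -UA mulmxA UTU mul1mx.
  have -> : 1%:M - A *m A = U^T *m diag_mx (\row_j (1 - mu j ^+ 2)) *m U.
    have -> : diag_mx (\row_j (1 - mu j ^+ 2)) =
        1%:M - diag_mx (\row_j mu j) *m diag_mx (\row_j mu j).
      apply/matrixP => i j; rewrite mul_diag_mx !mxE.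
      by case: eqP => [->|_]; rewrite ?mulr1n ?mulr0n ?mulr0 ?subr0 ?expr2.
    rewrite mulmxBr mulmx1 mulmxBl UTU {1}AE -!mulmxA; congr (_ - _ *m (_ *m _)).
    by rewrite -UA.
  apply/matrixP => i j; rewrite summxE.
  transitivity (\sum_l (1 - mu l ^+ 2) * (U l i * U l j)).
    rewrite mul_mx_diag mxE; apply: eq_bigr => l _; rewrite !mxE; ring.
  rewrite big_verts => [|l nl]; last by rewrite level_sqr // subrr mul0r.
  apply: eq_bigr => t _; rewrite !mxE mulr_sumr; apply: eq_bigr => x _.
  by rewrite !mxE /mu pos_v.
- move=> i x; rewrite mxE; have [<-|cix] := eqVneq (c i) x; first exact: Uroot.
  by rewrite Usupp ?eqxx // c_root eq_sym.
Qed.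

End SpectralFrame.

(** * Components of a graph *)

Section Components.
Variable G : sgraph.

Let connect_equiv : {in [set: G] & &, equivalence_rel (connect (@edge G))}.
Proof.
have sym : connect_sym (@edge G) by apply: sym_connect_sym => x y; exact: edge_sym.
move=> x y z _ _ _; split=> [|xy]; first exact: connect0.
by apply/idP/idP; apply: connect_trans; rewrite // sym.
Qed.

Lemma component_in (C : {set G}) x y :
  C \in components G -> x \in C -> (y \in C) = connect (@edge G) x y.
Proof.
move=> CG xC; have /and3P[_ tI _] := equivalence_partitionP connect_equiv.
by rewrite -(def_pblock tI CG xC) pblock_equivalence_partition ?inE.
Qed.

Lemma pblock_components x : finset.pblock (components G) x \in components G.
Proof.
have /and3P[/eqP cov _ _] := equivalence_partitionP connect_equiv.
by rewrite pblock_mem // cov inE.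
Qed.

Lemma eq_pblock_components (C : {set G}) x :
  C \in components G -> (finset.pblock (components G) x == C) = (x \in C).
Proof.
move=> CG; have /and3P[/eqP cov tI _] := equivalence_partitionP connect_equiv.
apply/eqP/idP => [<-|xC]; last exact: def_pblock.
by rewrite mem_pblock cov inE.
Qed.

Lemma component_gt0 (C : {set G}) : C \in components G -> (0 < #|C|)%N.
Proof.
have /and3P[_ _ P0] := equivalence_partitionP connect_equiv.
by move=> CG; rewrite card_gt0; apply: contraNneq P0 => <-.
Qed.

(** A component with two vertices contains an edge; one end is listed first, as root, and the other
    last, where the eigenvalue 1 may sit. *)
Lemma component_enumeration (C : {set G}) : C \in components G ->
  exists s : seq G, [/\ uniq s, s =i C &
    forall x0, (1 < size s)%N -> edge (nth x0 s (size s).-1) (nth x0 s 0)].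
Proof.
move=> CG; have [C1|] := leqP #|C| 1.
  exists (enum C); split; [exact: enum_uniq|exact: mem_enum|].
  by move=> x0; rewrite -cardE ltnNge C1.
case/card_gt1P => x [y] [xC yC xy].
have /connectP[p px yp] : connect (@edge G) x y by rewrite -(component_in _ CG xC).
case: p px yp => [|z p] /=; first by move=> _ yx; rewrite yx eqxx in xy.
case/andP=> xz _ _; have zC : z \in C by rewrite (component_in _ CG xC) connect1.
have zx : z != x by apply: contraTneq xz => ->; rewrite edge_irrefl.
exists (x :: rcons [seq w <- enum C | (w != x) && (w != z)] z); split.
- rewrite /= mem_rcons rcons_uniq filter_uniq ?enum_uniq // !inE !mem_filter !eqxx.
  by rewrite andbF orbF eq_sym zx.
- move=> w; rewrite inE mem_rcons inE mem_filter mem_enum.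
  have [->|_] := eqVneq w x; first by rewrite xC.
  by have [->|_] := eqVneq w z; first by rewrite zC.
- by move=> x0 _; rewrite nth_last /= last_rcons edge_sym.
Qed.

Lemma graph_spectral_frame (R : realType) k n :
  #|components G| = k -> (forall C, C \in components G -> (n < #|C| < n.+4)%N) ->
  exists (c : 'I_#|G| -> 'I_k) (A : 'M[R]_#|G|) (F : 'I_n.+1 -> 'M[R]_(#|G|, k)),
  [/\ inS A,
      forall t : 'I_n.+1, A *m F t = level R n.+1 t *: F t,
      forall t u, (F t)^T *m F u = (t == u)%:R%:M,
      1%:M - A *m A = \sum_(t < n.+1) (1 - level R n.+1 t ^+ 2) *: (F t *m (F t)^T) &
      forall i x, (F ord0 i x != 0) = (c i == x)].
Proof.
move=> Gk Gn; pose K := enum (components G).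
have sK : size K = k by rewrite -cardE.
pose e : rel 'I_#|G| := fun i j => edge (enum_val i) (enum_val j).
have c_lt (i : 'I_#|G|) : (index (finset.pblock (components G) (enum_val i)) K < k)%N.
  by rewrite -sK index_mem mem_enum pblock_components.
pose c i := Ordinal (c_lt i).
pose C (x : 'I_k) := nth finset.set0 K x.
have CG x : C x \in components G by rewrite -mem_enum mem_nth // sK.
have cE i x : (c i == x) = (enum_val i \in C x).
  rewrite -eq_pblock_components // -val_eqE /= /C.
  apply/eqP/eqP => [<-|->]; last by rewrite index_uniq ?enum_uniq ?sK.
  by rewrite nth_index // mem_enum pblock_components.
have cC i : enum_val i \in C (c i) by rewrite -cE.
have e_c i j : e i j -> c i = c j.
  by move=> eij; apply/eqP; rewrite eq_sym cE (component_in _ (CG _) (cC i)) connect1.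
have c_conn (P : pred 'I_#|G|) : (forall i j, e i j -> P i -> P j) ->
    forall i j, c i = c j -> P i -> P j.
  move=> Pcl i j /esym/eqP; rewrite cE (component_in _ (CG _) (cC i)) => con Pi.
  pose Q := [pred x : G | P (enum_rank x)].
  have Qcl : fingraph.closed (@edge G) Q.
    move=> x y xy; apply/idP/idP; apply: Pcl; rewrite /e !enum_rankK //.
    by rewrite edge_sym.
  by have := closed_connect Qcl con; rewrite !inE !enum_valK Pi => <-.
have [s sP] := fin_all_exists (fun x => component_enumeration (CG x)).
pose verts x := map enum_rank (s x).
exists c; apply: (@spectral_frame R #|G| k n e c verts).
- exact: vertex_nonempty.
- by move=> i j; apply: edge_sym.
- exact: e_c.
- exact: c_conn.
- by move=> x; have [su _ _] := sP x; rewrite map_inj_uniq //; apply: enum_rank_inj.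
- move=> x i; have [_ sC _] := sP x.
  by rewrite cE -sC -[i in LHS]enum_valK mem_map //; apply: enum_rank_inj.
- move=> x; have [su sC _] := sP x; rewrite size_map -(card_uniqP su) (eq_card sC).
  exact: Gn.
- move=> x i0; have [_ _ se] := sP x; rewrite size_map => sz.
  rewrite /e !(nth_map (enum_val i0)) ?sz // !enum_rankK.
  by have := se (enum_val i0); rewrite sz; apply.
Qed.

End Components.

(** * Nowhere zero coupling *)

(** A nonzero [p] has fewer than [size p] roots, so one of the first [size p] natural numbers is not
    a root. *)
Lemma exists_nonroot (R : numDomainType) (p : {poly R}) : p != 0 -> exists t, ~~ root p t.
Proof.
move=> p0; pose s := [seq i%:R : R | i <- iota 0 (size p)].
have su : uniq s by rewrite map_inj_uniq ?iota_uniq // => i j /eqP; rewrite eqr_nat => /eqP.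
have /allPn[t _ tp] : ~~ all (root p) s.
  by apply/negP => /(max_poly_roots p0)/(_ su); rewrite size_map size_iota ltnn.
by exists t.
Qed.

Section Householder.
Variables (R : realFieldType) (k : nat).

Definition powers_col (t : R) : 'cV[R]_k := \col_i t ^+ i.
(** The squared length of [powers_col t]. *)
Definition powers_norm (t : R) : R := \sum_(i < k) t ^+ i.*2.
Definition householder (t : R) : 'M[R]_k :=
  1%:M - (2 / powers_norm t) *: (powers_col t *m (powers_col t)^T).

Lemma householder_entry t i j :
  householder t i j = (i == j)%:R - 2 / powers_norm t * t ^+ (i + j).
Proof. by rewrite !mxE big_ord1 !mxE exprD. Qed.

Lemma powers_norm_gt0 t : (0 < k)%N -> 0 < powers_norm t.
Proof.
rewrite /powers_norm; case: k => // k' _; rewrite big_ord_recl expr0 ltr_pwDl // sumr_ge0 //.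
by move=> i _; rewrite -muln2 exprM sqr_ge0.
Qed.

Lemma householder_sym t : (householder t)^T = householder t.
Proof.
by apply/matrixP => i j; rewrite mxE !householder_entry eq_sym addnC.
Qed.

Lemma householder_orthogonal t : (0 < k)%N -> householder t *m (householder t)^T = 1%:M.
Proof.
move=> k0; have N0 := lt0r_neq0 (powers_norm_gt0 t k0).
rewrite householder_sym {1}/householder mulmxBl mul1mx -scalemxAl -mulmxA.
have -> : (powers_col t)^T *m householder t = - (powers_col t)^T.
  have ww : (powers_col t)^T *m powers_col t = (powers_norm t)%:M.
    apply/matrixP => i j; rewrite !ord1 !mxE eqxx mulr1n; apply: eq_bigr => l _.
    by rewrite !mxE -addnn exprD.
  rewrite mulmxBr mulmx1 -scalemxAr mulmxA ww mul_scalar_mx scalerA.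
  rewrite mulfVK // scaler_nat mulr2n opprD addrA subrr sub0r //.
by rewrite mulmxN scalerN opprK subrK.
Qed.

(* At least two monomials t^(2l) occur in the numerator's norm term when
   k >= 2, so the monomial t^(x+y) cannot cancel it. *)
Lemma householder_generic (I : finType) (a b : I -> R) (x y : I -> 'I_k) :
  (1 < k)%N -> (forall i, a i != 0) ->
  exists t, forall i, a i * householder t (x i) (y i) + b i != 0.
Proof.
move=> k1 a0; pose N : {poly R} := \sum_(l < k) 'X^(l.*2).
pose s i := a i * (x i == y i)%:R + b i.
(* [p i] is the desired entry with the denominator [powers_norm] cleared. *)
pose p i := s i *: N - (2 * a i) *: 'X^(x i + y i).
have N_eval t : N.[t] = powers_norm t.
  by rewrite horner_sum; apply: eq_bigr => l _; rewrite hornerXn.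
have N_coef (l : 'I_k) : N`_(l.*2) = 1.
  rewrite coef_sum (bigD1 l) //= coefXn eqxx big1 ?addr0 // => u ul.
  by rewrite coefXn (inj_eq double_inj) eq_sym val_eqE (negPf ul).
have p0 i : p i != 0.
  have [s0|s0] := eqVneq (s i) 0.
    by rewrite /p s0 scale0r sub0r oppr_eq0 scaler_eq0 mulf_eq0 pnatr_eq0
      (negPf (a0 i)) /= monic_neq0 ?monicXn.
  (* One of the exponents 0 and 2 differs from [x i + y i]; the coefficient of [p i] there is
     [s i]. *)
  have [l lxy] : exists l : 'I_k, l.*2 != (x i + y i)%N.
    have [xy|xy] := eqVneq (x i + y i)%N 0%N.
      by exists (Ordinal k1); rewrite xy.
    by exists (Ordinal (ltnW k1)); rewrite eq_sym.
  apply: contraNneq s0 => /(congr1 (fun q : {poly R} => q`_(l.*2))).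
  by rewrite coefB !coefZ N_coef coefXn (negPf lxy) coef0 mulr0 mulr1 subr0 => ->.
have [|t] := @exists_nonroot _ (\prod_i p i); first by apply/prodf_neq0.
rewrite /root horner_prod => /prodf_neq0 pt; exists t => i.
have N0 : powers_norm t != 0 by rewrite lt0r_neq0 // powers_norm_gt0 // ltnW.
apply: contraNneq (pt i isT) => h; apply/eqP.
rewrite /p hornerD hornerN !hornerZ N_eval hornerXn.
transitivity (powers_norm t * (a i * householder t (x i) (y i) + b i)).
  by rewrite householder_entry /s; field.
by rewrite h mulr0.
Qed.

End Householder.

(** Orthonormality of the [F'] kills the cross terms, and [Q t] cancels in the others. Exchanging
    [F] and [F'] serves for the product in the other order. *)
Lemma coupling_mulmx_tr (R : comNzRingType) (m m' k n : nat) (a : 'I_n -> R)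
    (F : 'I_n -> 'M[R]_(m, k)) (F' : 'I_n -> 'M[R]_(m', k)) (Q : 'I_n -> 'M[R]_k) :
  (forall t u, (F' t)^T *m F' u = (t == u)%:R%:M) ->
  (forall t, Q t *m (Q t)^T = 1%:M) ->
  let B := \sum_t a t *: (F t *m Q t *m (F' t)^T) in
  B *m B^T = \sum_t a t ^+ 2 *: (F t *m (F t)^T).
Proof.
move=> FF QQ B; rewrite {1}/B mulmx_suml; apply: eq_bigr => t _.
rewrite /B linear_sum mulmx_sumr (bigD1 t) //= big1 ?addr0 => [|u ut].
  rewrite linearZ /= -scalemxAl -scalemxAr scalerA -expr2; congr (_ *: _).
  rewrite !trmx_mul trmxK !mulmxA -[X in X *m _ *m _]mulmxA FF eqxx mulmx1.
  by rewrite -[X in X *m _]mulmxA QQ mulmx1.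
rewrite linearZ /= -scalemxAl -scalemxAr !trmx_mul trmxK !mulmxA.
rewrite -[X in X *m _ *m _]mulmxA FF eq_sym (negPf ut).
by rewrite raddf0 mulmx0 !mul0mx !scaler0.
Qed.

Section Coupling.
Variables (R : realType) (k n m m' : nat) (c : 'I_m -> 'I_k) (c' : 'I_m' -> 'I_k).
Variables (A : 'M[R]_m) (A' : 'M[R]_m').
Variables (F : 'I_n.+1 -> 'M[R]_(m, k)) (F' : 'I_n.+1 -> 'M[R]_(m', k)).
Variable lam : 'I_n.+1 -> R.
Hypothesis k_gt1 : (1 < k)%N.
Hypothesis lam_lt1 : forall t, lam t ^+ 2 < 1.
Hypothesis AT' : A'^T = A'.
Hypothesis AF : forall t, A *m F t = lam t *: F t.
Hypothesis AF' : forall t, A' *m F' t = lam t *: F' t.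
Hypothesis FF : forall t u, (F t)^T *m F u = (t == u)%:R%:M.
Hypothesis FF' : forall t u, (F' t)^T *m F' u = (t == u)%:R%:M.
Hypothesis AA : 1%:M - A *m A = \sum_t (1 - lam t ^+ 2) *: (F t *m (F t)^T).
Hypothesis AA' : 1%:M - A' *m A' = \sum_t (1 - lam t ^+ 2) *: (F' t *m (F' t)^T).
Hypothesis Fc : forall i x, (F ord0 i x != 0) = (c i == x).
Hypothesis Fc' : forall i x, (F' ord0 i x != 0) = (c' i == x).

Lemma nowhere_zero_coupling :
  exists B : 'M[R]_(m, m'),
  [/\ A *m A + B *m B^T = 1%:M, B^T *m B + A' *m A' = 1%:M,
      A *m B = B *m A' & forall i j, B i j != 0].
Proof.
pose a t := Num.sqrt (1 - lam t ^+ 2).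
have a_gt0 t : 0 < a t by rewrite sqrtr_gt0 subr_gt0.
have a_sqr t : a t ^+ 2 = 1 - lam t ^+ 2 by rewrite sqr_sqrtr // subr_ge0 ltW.
(* These terms do not involve the Householder parameter, so they supply the constants [b] of
   [householder_generic]. *)
pose rest : 'M_(m, m') := \sum_(t | t != ord0) a t *: (F t *m (F' t)^T).
have [s sB] := @householder_generic R k ('I_m * 'I_m')%type
  (fun ij => a ord0 * F ord0 ij.1 (c ij.1) * F' ord0 ij.2 (c' ij.2))
  (fun ij => rest ij.1 ij.2) (fun ij => c ij.1) (fun ij => c' ij.2) k_gt1
  (fun ij => mulf_neq0 (mulf_neq0 (lt0r_neq0 (a_gt0 ord0))
     (etrans (Fc _ _) (eqxx _))) (etrans (Fc' _ _) (eqxx _))).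
pose Q (t : 'I_n.+1) : 'M[R]_k := if t == ord0 then householder k s else 1%:M.
have QT t : (Q t)^T = Q t.
  by rewrite /Q; case: eqP => _; rewrite ?trmx1 // householder_sym.
have QQ t : Q t *m (Q t)^T = 1%:M.
  rewrite /Q; case: eqP => _; last by rewrite trmx1 mulmx1.
  by rewrite householder_orthogonal // ltnW.
pose B := \sum_t a t *: (F t *m Q t *m (F' t)^T).
(* Each [Q t] is symmetric, so transposition merely exchanges [F] and [F']. *)
have BT : B^T = \sum_t a t *: (F' t *m Q t *m (F t)^T).
  rewrite linear_sum; apply: eq_bigr => t _.
  by rewrite linearZ /= !trmx_mul trmxK QT mulmxA.
exists B; split.
- rewrite (coupling_mulmx_tr _ _ FF' QQ).
  under eq_bigr do rewrite a_sqr.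
  by rewrite -AA addrC subrK.
- have := coupling_mulmx_tr a F' FF QQ; rewrite /= -BT trmxK => ->.
  under eq_bigr do rewrite a_sqr.
  by rewrite -AA' subrK.
- rewrite mulmx_sumr mulmx_suml; apply: eq_bigr => t _.
  rewrite -scalemxAr -scalemxAl !mulmxA AF -!scalemxAl; congr (_ *: _).
  rewrite -[RHS]mulmxA -[A' in RHS]AT' -trmx_mul AF' linearZ /=.
  by rewrite -scalemxAr.
(* Row [i] of [F ord0] is supported at [c i] and row [j] of [F' ord0] at [c' j], so a single
   Householder entry survives. *)
- move=> i j; suff -> : B i j = a ord0 * F ord0 i (c i) * F' ord0 j (c' j)
      * householder k s (c i) (c' j) + rest i j by exact: (sB (i, j)).
  rewrite /B (bigD1 ord0) //= [LHS]mxE; congr (_ + _); last first.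
    rewrite /rest !summxE; apply: eq_bigr => t t0.
    by rewrite /Q (negPf t0) mulmx1.
  rewrite [LHS]mxE; set D := (_ *m _) i j.
  suff -> : D = F ord0 i (c i) * householder k s (c i) (c' j) * F' ord0 j (c' j) by ring.
  rewrite {}/D mxE (bigD1 (c' j)) //= big1 ?addr0 => [|y yj]; last first.
    rewrite [X in _ * X]mxE; have /negbFE/eqP-> : F' ord0 j y != 0 = false.
      by rewrite Fc' eq_sym (negPf yj).
    by rewrite mulr0.
  rewrite mxE (bigD1 (c i)) //= big1 ?addr0 => [|y yi]; last first.
    have /negbFE/eqP-> : F ord0 i y != 0 = false by rewrite Fc eq_sym (negPf yi).
    by rewrite mul0r.
  by rewrite [X in _ * X = _]mxE /Q eqxx.
Qed.

End Coupling.

(** * Eigenvalues of symmetric and involutive matrices *)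

Lemma eigenvalue_of_rows (F : fieldType) m (A V : 'M[F]_m) (a : F) :
  V != 0 -> V *m A = a *: V -> eigenvalue A a.
Proof.
case/matrix0Pn => i [j vij] vA; apply/eigenvalueP; exists (row i V).
  by rewrite -row_mul vA linearZ.
by apply: contraNneq vij => /rowP/(_ j); rewrite !mxE => ->.
Qed.

(** The complexification is Hermitian, hence diagonalisable with real eigenvalues; if these all
    agree, it is scalar. *)
Lemma symmetric_single_eigenvalue (R : rcfType) m (A : 'M[R]_m) :
  A^T = A -> (forall a b, eigenvalue A a -> eigenvalue A b -> a = b) ->
  forall i j, i != j -> A i j = 0.
Proof.
move=> AT A1 i j ij; pose C := map_mx (@real_complex R) A.
have herm : C \is hermsymmx.
  apply: realsym_hermsym.
    apply/is_hermitianmxP; rewrite expr0 scale1r map_mx_id //.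
    by apply/matrixP => x y; rewrite !mxE -[in LHS]AT mxE.
  by apply/mxOverP => x y; rewrite mxE; apply/complex_realP; exists (A x y).
have /orthomx_spectralP CE := hermitian_normalmx herm.
have Punit := spectral_unit C.
set P := spectralmx C in CE Punit; set D := spectral_diag C in CE.
have PC : P *m C = diag_mx D *m P by rewrite {1}CE !mulmxA mulmxV // mul1mx.
have Deig l : exists2 a, eigenvalue A a & D 0 l = (a%:C)%C.
  have /mxOverP/(_ 0 l)/complex_realP[a Da] := hermitian_spectral_diag_real herm.
  exists a => //; rewrite -(eigenvalue_map (@real_complex R)) -/C /= -Da -/D.
  apply/eigenvalueP; exists (row l P).
    by rewrite -row_mul PC row_mul row_diag_mx -scalemxAl -rowE.
  apply: contraTneq Punit => Pl; apply/negP => Punit.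
  have := congr1 (mulmx^~ (invmx P)) Pl; rewrite -row_mul mulmxV // mul0mx row1.
  by move/rowP/(_ l)/eqP; rewrite !mxE !eqxx oner_eq0.
have [a _ Da] := Deig i.
have DE : diag_mx D = (D 0 i)%:M.
  apply/matrixP => x y; rewrite !mxE; congr (_ *+ _).
  have [b bA ->] := Deig x; have [b' bA' ->] := Deig i.
  by rewrite (A1 _ _ bA bA').
have CD : C = (D 0 i)%:M by rewrite CE DE mul_mx_scalar -scalemxAl mulVmx // scalemx1.
have := congr1 (fun B : 'M_m => B i j) CD; rewrite !mxE (negPf ij) mulr0n.
by case.
Qed.

Lemma eigenvalue_in_fset_set (R : realType) m (A : 'M[R]_m) a :
  (a \in fset_set [set b | eigenvalue A b]%classic) = eigenvalue A a.
Proof.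
rewrite in_fset_set; last exact: finite_eigenvalues.
by apply/idP/idP; rewrite inE.
Qed.

Lemma num_eigenvalues_symmetric (R : realType) m (A : 'M[R]_m) i j :
  A^T = A -> i != j -> A i j != 0 -> (2 <= num_eigenvalues A)%N.
Proof.
move=> AT ij; apply: contraNT; rewrite -leqNgt => A1.
apply/eqP; apply: symmetric_single_eigenvalue ij => // a b Aa Ab.
apply/eqP; apply: contraTT A1 => ab; rewrite -ltnNge -[2%N]/(true.+1) -ab -cardfs2.
apply: fsubset_leq_card; apply/fsubsetP => x /fset2P.
by case=> ->; rewrite eigenvalue_in_fset_set.
Qed.

(** For [s = 1] and [s = -1], [(A + s) A = s (A + s)], and [A + s] is nonzero because of the
    off-diagonal entry; so both signs occur, and [a ^+ 2 = 1] excludes other eigenvalues. *)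
Lemma num_eigenvalues_involution (R : realType) m (A : 'M[R]_m) i j :
  A *m A = 1%:M -> i != j -> A i j != 0 -> num_eigenvalues A = 2%N.
Proof.
move=> AA ij Aij; rewrite /num_eigenvalues.
suff -> : fset_set [set a | eigenvalue A a]%classic = [fset 1; -1]%fset.
  rewrite cardfs2; suff -> : 1 != -1 :> R by [].
  by rewrite -subr_eq0 opprK -mulr2n pnatr_eq0.
have shift (s : R) : s ^+ 2 = 1 -> eigenvalue A s.
  move=> s1; apply: (@eigenvalue_of_rows _ _ _ (A + s%:M)).
    apply: contraNneq Aij => /matrixP/(_ i j); rewrite !mxE (negPf ij) addr0.
    by move->.
  by rewrite mulmxDl AA mul_scalar_mx scalerDr scale_scalar_mx -expr2 s1 addrC.
apply/fsetP => a; rewrite eigenvalue_in_fset_set in_fset2; apply/idP/idP; last first.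
  by case/orP => /eqP->; apply: shift; rewrite ?sqrrN expr1n.
case/eigenvalueP => v vA v0.
have : a ^+ 2 *: v = v by rewrite expr2 -scalerA -vA scalemxAl -vA -mulmxA AA mulmx1.
move/eqP; rewrite -{2}[v]scale1r -subr_eq0 -scalerBl scaler_eq0 (negPf v0) orbF.
by rewrite subr_eq0 sqrf_eq1.
Qed.

(** * The block matrix transported to the vertices of the join *)

Section JoinMatrix.
Variables (R : realType) (G H : sgraph).
Variables (A : 'M[R]_#|G|) (A' : 'M[R]_#|H|) (B : 'M[R]_(#|G|, #|H|)).

Let M := block_mx A B B^T (- A').

Let to_block (i : 'I_#|join G H|) : 'I_(#|G| + #|H|) :=
  match enum_val i : G + H with
  | inl x => lshift #|H| (enum_rank x)
  | inr y => rshift #|G| (enum_rank y)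
  end.

Definition join_matrix : 'M[R]_#|join G H| := mxsub to_block to_block M.

Let of_block (s : 'I_(#|G| + #|H|)) : 'I_#|join G H| :=
  @enum_rank (join G H) (match fintype.split s with
    | inl a => inl (enum_val a)
    | inr b => inr (enum_val b)
    end).

Let to_blockK : cancel to_block of_block.
Proof.
move=> i; rewrite /to_block /of_block -[RHS]enum_valK; congr enum_rank.
by case: (enum_val i) => x; [rewrite (unsplitK (inl _))|rewrite (unsplitK (inr _))];
  rewrite enum_rankK.
Qed.

Let of_blockK : cancel of_block to_block.
Proof.
move=> s; rewrite /to_block /of_block enum_rankK -[RHS]splitK.
by case: (fintype.split s) => x; rewrite enum_valK.
Qed.

Lemma join_matrix_inS :
  inS A -> inS A' -> (forall i j, B i j != 0) -> inS join_matrix.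
Proof.
move=> [AT Ae] [AT' Ae'] B0; split.
  rewrite /join_matrix trmx_mxsub /M tr_block_mx AT trmxK linearN /= AT' //.
move=> i j ij; rewrite mxE /to_block.
have : enum_val i != enum_val j by rewrite (inj_eq enum_val_inj).
rewrite /= /join_edge.
case: (enum_val i) (enum_val j) => x [] y xy.
- by rewrite block_mxEul Ae ?enum_rankK // (inj_eq enum_rank_inj).
- by rewrite block_mxEur B0.
- by rewrite block_mxEdl mxE B0.
- by rewrite block_mxEdr mxE oppr_eq0 Ae' ?enum_rankK // (inj_eq enum_rank_inj).
Qed.

Lemma join_matrix_involution :
  A *m A + B *m B^T = 1%:M -> B^T *m B + A' *m A' = 1%:M -> A *m B = B *m A' ->
  A^T = A -> A'^T = A' -> join_matrix *m join_matrix = 1%:M.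
Proof.
move=> h1 h2 h3 AT AT'.
have MM : M *m M = 1%:M.
  rewrite /M mulmx_block !mulmxN !mulNmx opprK h1 h2 h3 subrr.
  (* The lower left block is the transpose of the upper right one. *)
  have -> : B^T *m A - A' *m B^T = 0.
    by rewrite -[A in X in X - _]AT -[A']AT' -!trmx_mul h3 subrr.
  by rewrite -scalar_mx_block.
have bij : bijective to_block by exists of_block.
apply/matrixP => i j; rewrite mxE.
transitivity ((M *m M) (to_block i) (to_block j)).
  by rewrite mxE (reindex to_block) /=; [apply: eq_bigr => l _; rewrite !mxE|exact: onW_bij].
by rewrite MM !mxE (inj_eq (bij_inj bij)).
Qed.

End JoinMatrix.

Theorem theorem3p2 (R : realType) (G H : sgraph) (k : nat)
  (hk : (2 <= k)%N)
  (hG : #|components G| = k)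
  (hH : #|components H| = k)
  (hn : exists n : nat,
    (forall C : {set G}, C \in components G ->
       [\/ #|C| = n, #|C| = n.+1 | #|C| = n.+2]) /\
    (forall C : {set H}, C \in components H ->
       [\/ #|C| = n, #|C| = n.+1 | #|C| = n.+2])) :
  q R (join G H) = 2%N.
Proof.
have [n [nG nH]] := hn.
(* The frames use the base order [n.-1.+1]. This is [n] unless [n = 0], when nonemptiness leaves the
   orders 1 and 2, which fit the base order 1. *)
have size_bounds (K : sgraph) : (forall C : {set K}, C \in components K ->
      [\/ #|C| = n, #|C| = n.+1 | #|C| = n.+2]) ->
    forall C : {set K}, C \in components K -> (n.-1 < #|C| < n.-1.+4)%N.
  by move=> nK C CK; have := component_gt0 CK; case: (nK C CK) => ->; lia.
have [c [A [F [AS AF FF AA Fc]]]] := graph_spectral_frame R hG (size_bounds _ nG).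
have [c' [A' [F' [AS' AF' FF' AA' Fc']]]] :=
  graph_spectral_frame R hH (size_bounds _ nH).
have lt1 (t : 'I_n.-1.+1) : level R n.-1.+1 t ^+ 2 < 1.
  by have /andP[l0 l1] := level_gt0_lt1 R (ltn_ord t); rewrite expr_lt1 // ltW.
have [B [h1 h2 h3 B0]] := nowhere_zero_coupling hk lt1
  AS'.1 AF AF' FF FF' AA AA' Fc Fc'.
have MS := join_matrix_inS AS AS' B0.
have MM := join_matrix_involution h1 h2 h3 AS.1 AS'.1.
have /card_gt0P[x _] := vertex_nonempty G; have /card_gt0P[y _] := vertex_nonempty H.
pose i := @enum_rank (join G H) (inl x); pose j := @enum_rank (join G H) (inr y).
have ij : i != j by rewrite (inj_eq enum_rank_inj).
(* An edge between the two sides gives the nonzero off-diagonal entry that both the lower and the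
   upper bound require. *)
have adj (M : 'M[R]_#|join G H|) : inS M -> M i j != 0.
  by case=> _ ->; rewrite // !enum_rankK.
rewrite /q; case: ex_minnP => d /asboolP[M [MSd <-]] min.
apply/eqP; rewrite eqn_leq; apply/andP; split; last first.
  by apply: num_eigenvalues_symmetric ij _; [case: MSd|exact: adj].
apply: min; apply/asboolP; exists (join_matrix A A' B); split=> //.
by apply: num_eigenvalues_involution ij _ => //; apply: adj.
Qed.
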